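(* Let $I=[0,1)$ and let $\theta$ be a natural coding of an injective $n$-PC $f:I\to I$, with complexity function $p_\theta$. Then: (i) There exist $\alpha\in\{0,1,\ldots,n-1\}$, $\beta\ge1$ and $k_0\ge1$ such that $p_\theta(k)=\alpha k+\beta$ for every $k\ge k_0$, with $\beta=1$ if $\alpha=n-1$. (ii) If $n\ge2$, $T:I\to I$ is a standard $n$-IET satisfying the i.d.o.c., and $f=f_T$ is an injective piecewise $\frac12$-affine contraction of $n$ intervals for which there is a continuous, surjective, nondecreasing map $h:I\to I$ with $\theta_{f}(x)=\theta_T(h(x))$ for every $x\in I$, then $p_\theta(k)=(n-1)k+1$ for every $k\ge1$.
   Context: $I=[0,1)$. A map $f:I\to I$ is a piecewise contraction of $n$ intervals ($n$-PC) if there exist $0<\lambda<1$ and a partition of $I$ into non-degenerate intervals $I_1,\ldots,I_n$ (listed from left to right, fixed together with $f$) such that $f|_{I_i}$ is $\lambda$-Lipschitz for every $i$. It is a piecewise $\lambda$-affine contraction of $n$ intervals if moreover there are $b_i\in\mathbb{R}$ and $\sigma_i\in\{-1,1\}$ with $f(x)=\sigma_i\lambda x+b_i$ for $x\in I_i$, $1\le i\le n$. A standard $n$-interval exchange transformation (standard $n$-IET) is a bijection $T:I\to I$ for which there are a partition of $I$ into non-degenerate left-closed right-open intervals $I_1,\ldots,I_n$ (listed from left to right, fixed together with $T$) and $b_1,\ldots,b_n\in\mathbb{R}$ with $T(x)=x+b_i$ for $x\in I_i$. Writing $0=x_0<x_1<\cdots<x_n=1$ for the endpoints of the partition, $T$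 satisfies the infinite distinct orbit condition (i.d.o.c.) if the orbits $\{x_i,T(x_i),T^2(x_i),\ldots\}$, $1\le i\le n-1$, are infinite and pairwise disjoint. For $g$ a PC or an IET with partition $I_1,\ldots,I_n$, the natural $g$-coding of $x\in I$ is the infinite word $\theta_g(x)=\theta_0\theta_1\ldots$ with $\theta_k=i$ whenever $g^k(x)\in I_i$ ($k\ge0$); the natural codings of $g$ are the words $\theta_g(x)$, $x\in I$. The complexity function of an infinite word $\theta$ is $p_\theta(k)=\#L_k(\theta)$, where $L_k(\theta)=\{\theta_m\theta_{m+1}\cdots\theta_{m+k-1}:m\ge0\}$ is the set of finite subwords of length $k$ occurring in $\theta$. *)

(* Defs.v *)
From HB Require Import structures.
From mathcomp Require Export all_boot all_order all_algebra.
From mathcomp Require Export all_classical all_reals all_analysis.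
Set Implicit Arguments.
Unset Strict Implicit.
Unset Printing Implicit Defensive.
Import Order.TTheory GRing.Theory Num.Theory.
Import numFieldNormedType.Exports.
Local Open Scope classical_set_scope.
Local Open Scope ring_scope.

(* Self-maps of [0, 1) are total functions R -> R stabilizing [0, 1); their
   values outside [0, 1) are irrelevant.  The intervals I_1, ..., I_n are
   indexed from 0, by 'I_n. *)
Definition unitI (R : realType) : set R := `[0, 1[%classic.
Arguments unitI : clear implicits.

Definition interval_partition (R : realType) (n : nat) (P : 'I_n -> set R) :=
  [/\ classical_sets.partition setT P (unitI R),
      forall i, is_interval (P i),
      forall i, exists x y, [/\ P i x, P i y & x < y]
    & forall i j : 'I_n, (i < j)%N -> forall x y, P i x -> P j y -> x < y].

Definition PC_ratio (R : realType) (n : nat) (lambda : R) (f : R -> R)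
    (P : 'I_n -> set R) :=
  [/\ 0 < lambda < 1, set_fun (unitI R) (unitI R) f, interval_partition P
    & forall i, lambda.-lipschitz_(P i) f].

Definition is_PC (R : realType) (n : nat) (f : R -> R) (P : 'I_n -> set R) :=
  exists lambda : R, PC_ratio lambda f P.

Definition is_affine_PC (R : realType) (n : nat) (lambda : R) (f : R -> R)
    (P : 'I_n -> set R) :=
  PC_ratio lambda f P /\
  exists b sigma : 'I_n -> R, forall i, (sigma i = -1 \/ sigma i = 1) /\
    forall x, P i x -> f x = sigma i * lambda * x + b i.

Definition is_IET (R : realType) (n : nat) (T : R -> R) (P : 'I_n -> set R) :=
  [/\ set_bij (unitI R) (unitI R) T, interval_partition P,
      forall i, exists a b, P i = `[a, b[%classic
    & exists b : 'I_n -> R, forall i x, P i x -> T x = x + b i].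

Definition orbit_set (X : Type) (g : X -> X) (x : X) : set X :=
  [set iter k g x | k in [set: nat]].

(* As indices start at 0, the endpoints x_1, ..., x_(n-1) of the partition are
   the left endpoints inf (P i) of the pieces of index i > 0. *)
Definition idoc (R : realType) (n : nat) (T : R -> R) (P : 'I_n -> set R) :=
  let x_ (i : 'I_n) := inf (P i) in
  (forall i : 'I_n, (0 < i)%N -> infinite_set (orbit_set T (x_ i))) /\
  (forall i j : 'I_n, (0 < i)%N -> (0 < j)%N -> i != j ->
     orbit_set T (x_ i) `&` orbit_set T (x_ j) = set0).

(* theta is the natural coding of x; it is unique when the P i are disjoint. *)
Definition codes (R : realType) (n : nat) (g : R -> R) (P : 'I_n -> set R)
    (x : R) (theta : nat -> 'I_n) :=
  forall k, P (theta k) (iter k g x).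

Definition language (A : finType) (theta : nat -> A) (k : nat) :
    {set k.-tuple A} :=
  [set u | `[< exists m, u = [tuple theta (m + i)%N | i < k] >]]%SET.

Definition complexity (A : finType) (theta : nat -> A) (k : nat) : nat :=
  #|language theta k|.

(* Main.v *)
(* Let [s k = p (k + 1) - p k]. Images under [f^k] of distinct cylinders of
   length [k] are disjoint intervals, so [s k] is the number of cuts between
   consecutive letters straddled by the extensions of a single word of length
   [k]. A cut straddled for [k + 1] is straddled for [k] (drop the first letter),
   so [s] is nonincreasing and bounded by [n - 1], which gives (i).
   For (ii), [theta] also codes a point of [T], and the i.d.o.c. makes every
   forward orbit of [T] dense (Keane). Hence the orbit visits both sides of each
   [T^-k x_i] within its cylinder of length [k]: all [n - 1] cuts are straddled
   for every [k]. *)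
Require Import Defs.
From mathcomp Require Import all_boot all_order all_algebra.
From mathcomp Require Import all_classical all_reals all_analysis.
From mathcomp Require Import zify lra.
Set Implicit Arguments.
Unset Strict Implicit.
Unset Printing Implicit Defensive.
Import Order.TTheory GRing.Theory Num.Theory.
Import numFieldNormedType.Exports.
Local Open Scope classical_set_scope.
Local Open Scope ring_scope.

(** * Words: counting the right extensions of factors *)

Section Words.
Variables (n : nat) (theta : nat -> 'I_n).

Definition factor (k m : nat) : k.-tuple 'I_n :=
  [tuple theta (m + i)%N | i < k].

Lemma factorP (k m m' : nat) :
  factor k m = factor k m' <->
  (forall i, (i < k)%N -> theta (m + i)%N = theta (m' + i)%N).
Proof.
split=> [e i ik|e]; last by apply: eq_from_tnth => i; rewrite !tnth_mktuple e.
by have := congr1 (fun u => tnth u (Ordinal ik)) e; rewrite !tnth_mktuple.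
Qed.

Lemma factorSP (k m m' : nat) :
  factor k.+1 m = factor k.+1 m' <->
  factor k m = factor k m' /\ theta (m + k)%N = theta (m' + k)%N.
Proof.
rewrite !factorP; split=> [e|[e ek] i].
  by split=> [i ik|]; apply: e => //; apply: ltnW.
by rewrite ltnS leq_eqVlt => /predU1P[->|/e].
Qed.

Lemma languageP (k : nat) (u : k.-tuple 'I_n) :
  reflect (exists m, u = factor k m) (u \in language theta k).
Proof. by rewrite inE; apply: asboolP. Qed.

Lemma factor_language (k m : nat) : factor k m \in language theta k.
Proof. by apply/languageP; exists m. Qed.

(* The letters that extend some word of length [k] in the language without being
   its least extension; each is read as the cut just below that letter. *)
Definition cuts (k : nat) : {set 'I_n} :=
  [set a | `[< exists m m', [/\ factor k m = factor k m', theta (m + k)%N = a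
                              & (theta (m' + k)%N < a)%N] >]]%SET.

Lemma cutsP (k : nat) (a : 'I_n) :
  reflect (exists m m', [/\ factor k m = factor k m', theta (m + k)%N = a
                          & (theta (m' + k)%N < a)%N]) (a \in cuts k).
Proof. by rewrite inE; apply: asboolP. Qed.

(** All that the count needs from the dynamics: for each length, a given cut is straddled by the
    extensions of at most one word. *)
Definition noncrossing := forall k m1 m2 m3 m4,
  factor k m1 = factor k m2 -> factor k m3 = factor k m4 ->
  theta (m1 + k)%N = theta (m3 + k)%N ->
  (theta (m2 + k)%N < theta (m1 + k)%N)%N ->
  (theta (m4 + k)%N < theta (m3 + k)%N)%N -> factor k m1 = factor k m3.

(** Deleting the last letter maps the words ending in the least extension of their prefix, gathered
    in [M], bijectively onto the words of length [k]. The other words of length [k.+1] are told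
    apart by their last letter thanks to [noncrossing], and these letters form [cuts k]. *)
Lemma complexityS (k : nat) : noncrossing ->
  complexity theta k.+1 = (complexity theta k + #|cuts k|)%N.
Proof.
move=> nc; rewrite /complexity.
pose pre (v : k.+1.-tuple 'I_n) : k.-tuple 'I_n :=
  [tuple tnth v (widen_ord (leqnSn k) i) | i < k].
pose lst (v : k.+1.-tuple 'I_n) := tnth v ord_max.
have preE m : pre (factor k.+1 m) = factor k m.
  by apply: eq_from_tnth => i; rewrite !tnth_mktuple.
have lstE m : lst (factor k.+1 m) = theta (m + k)%N by rewrite /lst tnth_mktuple.
pose M : {set k.+1.-tuple 'I_n} := [set v | [forall v' in language theta k.+1,
  (pre v' == pre v) ==> (lst v <= lst v')%N]]%SET.
have MP m : reflect (forall m', factor k m' = factor k m ->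
    (theta (m + k) <= theta (m' + k))%N) (factor k.+1 m \in M).
  rewrite inE; apply: (iffP forall_inP) => [h m' e|h _ /languageP[m' ->]].
    by have := h _ (factor_language k.+1 m'); rewrite !preE !lstE e eqxx.
  by rewrite !preE !lstE; apply/implyP => /eqP/h.
rewrite -(cardsID M (language theta k.+1)); congr (_ + _)%N.
- have <- : (pre @: (language theta k.+1 :&: M) = language theta k)%SET.
    apply/setP => u; apply/imsetP/languageP => [[v]|[m ->]].
      by rewrite inE => /andP[/languageP[m ->] _] ->; exists m.
    pose E := [set v in language theta k.+1 | pre v == factor k m]%SET.
    have mE : factor k.+1 m \in E by rewrite inE factor_language preE eqxx.
    case: (@arg_minnP _ _ (fun v => v \in E) (fun v => lst v : nat) mE) => v.
    rewrite inE => /andP[/languageP[m' ->]]; rewrite preE => /eqP em vmin.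
    exists (factor k.+1 m'); last by rewrite preE.
    rewrite inE factor_language; apply/MP => m'' em'.
    by rewrite -!lstE vmin// inE factor_language preE em' em eqxx.
  rewrite card_in_imset// => v v' /setIP[/languageP[m ->] /MP h].
  move=> /setIP[/languageP[m' ->] /MP h']; rewrite !preE => e.
  apply/factorSP; split=> //; apply/val_inj/eqP; rewrite /= eqn_leq.
  by rewrite h// h'.
- have Nex m : factor k.+1 m \notin M ->
    exists2 m', factor k m' = factor k m & (theta (m' + k) < theta (m + k))%N.
    move=> /MP h; apply: contrapT => h'; apply: h => m' e.
    by rewrite leqNgt; apply/negP => lt; apply: h'; exists m'.
  have <- : (lst @: (language theta k.+1 :\: M) = cuts k)%SET.
    apply/setP => a; apply/imsetP/cutsP => [[v]|[m [m' [e ea lt]]]].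
      move=> /setDP[/languageP[m ->] /Nex[m' e lt]] ->.
      by exists m, m'; rewrite lstE.
    exists (factor k.+1 m); last by rewrite lstE.
    rewrite inE factor_language andbT; apply/MP => /(_ m' (esym e)).
    by rewrite leqNgt ea lt.
  rewrite card_in_imset// => v v'.
  move=> /setDP[/languageP[m ->] /Nex[m1 e1 lt1]].
  move=> /setDP[/languageP[m' ->] /Nex[m2 e2 lt2]].
  rewrite !lstE => e; apply/factorSP; split=> //.
  exact: (nc _ _ m1 _ m2).
Qed.

(** Two words that straddle a cut still straddle it after their common first letter is dropped. *)
Lemma cuts_subset (k k' : nat) : (k <= k')%N -> cuts k' \subset cuts k.
Proof.
move=> /subnK <-; elim: (k' - k)%N => [|d IH]; first exact: fintype.subxx.
apply: fintype.subset_trans IH; apply/fintype.subsetP => a.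
move=> /cutsP[m [m' [/factorP e ea lt]]].
have sh p : (p.+1 + (d + k) = p + (d.+1 + k))%N by lia.
apply/cutsP; exists m.+1, m'.+1; split; rewrite ?sh//.
by apply/factorP => i id; rewrite !addSnnS e.
Qed.

(** No letter lies below the letter 0, so 0 is never a cut. *)
Lemma card_cuts (k : nat) : (#|cuts k| <= n - 1)%N.
Proof.
have n0 : (0 < n)%N by case: n theta => // th; case: (th 0%N).
have -> : (n - 1)%N = #|[set~ Ordinal n0]%SET| by rewrite cardsC1 card_ord subn1.
apply/subset_leq_card/fintype.subsetP => a /cutsP[m [m' [_ _ lt]]].
by rewrite !inE; apply/negP => /eqP ae; move: lt; rewrite ae.
Qed.

Lemma complexity0 : complexity theta 0 = 1%N.
Proof.
rewrite /complexity (_ : language theta 0 = [set [tuple]]%SET) ?cards1//.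
apply/setP => u; rewrite [u]tuple0 set11.
by apply/languageP; exists 0%N; rewrite [RHS]tuple0.
Qed.

(* The number of cuts is nonincreasing, hence eventually equal to its minimum. *)
Lemma noncrossing_complexity : noncrossing -> exists alpha beta k0 : nat,
  [/\ (alpha <= n - 1)%N, (1 <= beta)%N, (1 <= k0)%N,
      forall k, (k0 <= k)%N -> complexity theta k = (alpha * k + beta)%N
    & alpha = (n - 1)%N -> beta = 1%N].
Proof.
move=> nc.
have exa : exists a, `[< exists k, #|cuts k| = a >].
  by exists #|cuts 0|; apply/asboolP; exists 0%N.
case: (ex_minnP exa) => alpha /asboolP[k1 k1E] amin.
have amin' k : (alpha <= #|cuts k|)%N by apply: amin; apply/asboolP; exists k.
have cst k : (k1 <= k)%N -> #|cuts k| = alpha.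
  move=> k1k; apply/eqP; rewrite eqn_leq amin' andbT -k1E.
  exact/subset_leq_card/cuts_subset.
(* This bound keeps the natural-number subtraction that defines [beta] from truncating, and makes
   [beta] positive. *)
have lin k : (alpha * k + 1 <= complexity theta k)%N.
  elim: k => [|k IH]; first by rewrite complexity0 muln0.
  by rewrite complexityS//; have := amin' k; lia.
have lin1 k : (k1.+1 <= k)%N -> complexity theta k =
    (alpha * k + (complexity theta k1.+1 - alpha * k1.+1))%N.
  move=> /subnK <-; elim: (k - k1.+1)%N => [|d IH].
    by rewrite add0n; have := lin k1.+1; lia.
  by rewrite addSn complexityS// IH cst; lia.
exists alpha, (complexity theta k1.+1 - alpha * k1.+1)%N, k1.+1; split => //.
- by rewrite -k1E card_cuts.
- by have := lin k1.+1; lia.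
(* All increments are squeezed between [alpha] and [n - 1], so the affine formula is exact from
   length 0 on, where the complexity is 1. *)
- move=> an; suff -> : complexity theta k1.+1 = (alpha * k1.+1 + 1)%N by lia.
  elim: k1.+1 => [|k IH]; first by rewrite complexity0 muln0.
  rewrite complexityS// IH; have := card_cuts k; have := amin' k; lia.
Qed.

End Words.

(** * Codings of piecewise contractions: images of cylinders *)

Lemma lipschitz_IVT (R : realType) (k : R) (A : set R) (f : R -> R) (x y v : R) :
  0 < k -> is_interval A -> k.-lipschitz_A f -> A x -> A y ->
  f x <= v <= f y -> exists2 c, A c & f c = v.
Proof.
(* The values [f x] and [f y] are ordered but [x] and [y] are not, since [f] may reverse a piece;
   hence the minimum and maximum. *)
move=> k0 Ai fk; wlog suff : x y / x <= y -> A x -> A y ->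
    forall v, Num.min (f x) (f y) <= v <= Num.max (f x) (f y) ->
    exists2 c, A c & f c = v.
  move=> IVTle Ax Ay /andP[fxv vfy]; have fxy := le_trans fxv vfy.
  case: (leP x y) => [xy|/ltW yx].
    by apply: (IVTle x y) => //; rewrite min_l// max_r// fxv.
  by apply: (IVTle y x) => //; rewrite min_r// max_l// fxv.
move=> xy Ax Ay {}v fv.
have sub z : z \in `[x, y] -> A z by rewrite in_itv; apply: Ai.
have [|c cxy <-] := IVT xy _ fv; last by exists c => //; apply: sub.
apply/subspace_continuousP => z /= zxy; apply/cvgrPdist_le => e e0.
near=> t.
have xyt : t \in `[x, y] by near: t; apply: withinT.
have /= := fk (z, t) (conj (sub _ zxy) (sub _ xyt)).
move/le_trans; apply; rewrite -ler_pdivlMl// mulrC ltW//.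
near: t; apply: cvg_within.
by apply: nbhsx_ballx; rewrite divr_gt0.
Unshelve. all: by end_near.
Qed.

Section Coding.
Variables (R : realType) (n : nat) (g : R -> R) (P : 'I_n -> set R).
Hypothesis partP : interval_partition P.
Hypothesis g_fun : set_fun (unitI R) (unitI R) g.

Lemma piece_cover (z : R) : unitI R z -> exists i, P i z.
Proof. by case: partP => -[<- _ _] _ _ _ [i _ Piz]; exists i. Qed.

Lemma piece_unitI (i : 'I_n) (z : R) : P i z -> unitI R z.
Proof. by case: partP => -[<- _ _] _ _ _ Piz; exists i. Qed.

Lemma piece_inj (i j : 'I_n) (z : R) : P i z -> P j z -> i = j.
Proof. by case: partP => -[_ triv _] _ _ _ Pi Pj; apply: triv => //; exists z. Qed.

Lemma piece_lt (i j : 'I_n) (y z : R) : (i < j)%N -> P i y -> P j z -> y < z.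
Proof. by case: partP => _ _ _ + ij; apply. Qed.

Lemma piece_le (i j : 'I_n) (y z : R) : P i y -> P j z -> y <= z -> (i <= j)%N.
Proof.
by move=> Pi Pj yz; rewrite leqNgt; apply/negP => /piece_lt/(_ Pj Pi); lra.
Qed.

Lemma iter_unitI (k : nat) (z : R) : unitI R z -> unitI R (iter k g z).
Proof. by move=> Iz; elim: k => //= k; apply: g_fun. Qed.

Lemma iter_set_inj (k : nat) : set_inj (unitI R) g ->
  set_inj (unitI R) (iter k g).
Proof.
move=> g_inj; elim: k => [|k IH] y z Iy Iz //= e.
apply: IH => //; apply: g_inj => //; rewrite inE; apply: iter_unitI.
- by rewrite inE in Iy.
- by rewrite inE in Iz.
Qed.

Lemma codes_inj (x : R) (theta theta' : nat -> 'I_n) :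
  codes g P x theta -> codes g P x theta' -> theta = theta'.
Proof.
by move=> c c'; apply/funext => k; apply: piece_inj (c k) (c' k).
Qed.

End Coding.

(* Distinct words of length [k] have disjoint cylinders, whose images under
   [f^k] are disjoint intervals; at most one of them straddles a given cut. *)
Lemma PC_noncrossing (R : realType) (n : nat) (f : R -> R) (P : 'I_n -> set R)
    (theta : nat -> 'I_n) (x : R) :
  is_PC f P -> set_inj (unitI R) f -> unitI R x -> codes f P x theta ->
  noncrossing theta.
Proof.
move=> [lambda [/andP[l0 _] f_fun partP f_lip]] f_inj Ix cod.
pose cyl k m : set R := [set z | unitI R z /\
  forall i, (i < k)%N -> P (theta (m + i)%N) (iter i f z)].
(* Lengthening the word intersects the previous image, an interval, with one piece and applies [f],
   which is continuous there. *)
have cyl_itv k m : is_interval [set iter k f z | z in cyl k m].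
  elim: k => [|k IH].
    move=> _ _ [y [Iy _] <-] [z [Iz _] <-] v /= vyz; exists v => //; split=> //.
    by move: Iy Iz vyz; rewrite /unitI /= !in_itv /= => ? ? ?; lra.
  pose S := [set iter k f z | z in cyl k m] `&` P (theta (m + k)%N).
  have SE v : (exists2 c, S c & f c = v) ->
      [set iter k.+1 f z | z in cyl k.+1 m] v.
    move=> [c [[z [Iz cz] zc] Pc] fcv]; exists z => /=; last by rewrite zc.
    split=> // i; rewrite ltnS leq_eqVlt => /predU1P[->|/cz//].
    by rewrite zc.
  have Sitv : is_interval S.
    move=> y z [Sy Py] [Sz Pz] v vyz; split; first exact: IH vyz.
    by case: partP => _ + _ _; apply; first exact: Py; first exact: Pz.
  have SI z : cyl k.+1 m z -> S (iter k f z).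
    move=> [Iz cz]; split; last exact: cz.
    by exists z => //; split=> // i /ltnW/cz.
  move=> _ _ [y /SI Sy <-] [z /SI Sz <-] v vyz; apply: SE.
  apply: (@lipschitz_IVT _ lambda _ f _ _ _ _ Sitv _ Sy Sz) => //.
  move=> [u w] /= [[_ Pu] [_ Pw]]; exact: (f_lip _ (u, w) (conj Pu Pw)).
have cyl_factor k m m' : factor theta k m = factor theta k m' ->
    cyl k m (iter m' f x).
  move=> /factorP e; split; first exact: iter_unitI.
  by move=> i ik; rewrite e// -iterD addnC; apply: cod.
have cyl_inj k m m' z : cyl k m z -> cyl k m' z -> factor theta k m = factor theta k m'.
  move=> [_ c] [_ c']; apply/factorP => i ik.
  exact: (piece_inj partP) (c i ik) (c' i ik).
(* The two words play symmetric roles, so the visit of the first below the cut may be taken to lie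
   left of that of the second. *)
move=> k m1 m2 m3 m4; wlog le : m1 m2 m3 m4 / iter (m2 + k) f x <= iter (m4 + k) f x.
  move=> H e12 e34 e13 l2 l4.
  case: (leP (iter (m2 + k) f x) (iter (m4 + k) f x)) => [le|/ltW le].
    exact: (H _ m2 _ m4).
  by apply/esym; apply: (H _ m4 _ m2).
move=> e12 e34 e13 _ l4.
(* The lower visit of the second word thus lies between the two visits of the first, inside the
   image of the first cylinder; injectivity of [f^k] then makes the two cylinders meet. *)
have lt41 : iter (m4 + k) f x < iter (m1 + k) f x.
  by rewrite -e13 in l4; apply: (piece_lt partP) l4 (cod _) (cod _).
have im m m' : factor theta k m = factor theta k m' ->
    [set iter k f z | z in cyl k m] (iter (m' + k) f x).
  by move=> e; exists (iter m' f x); [exact: cyl_factor|rewrite -iterD addnC].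
have [|z cz zE] := cyl_itv k m1 _ _ (im _ _ e12) (im _ _ erefl) (iter (m4 + k) f x).
  by rewrite le ltW.
move: zE; rewrite addnC iterD => zE.
have c4 := cyl_factor _ _ _ e34.
have zx : z = iter m4 f x.
  apply: (iter_set_inj f_fun f_inj _ _ zE); rewrite inE; first by case: cz.
  by case: c4.
by apply: cyl_inj cz _; rewrite zx.
Qed.

(** * Auxiliary facts: induction along a segment, close returns, periodic orbits *)

Lemma real_induction (R : realType) (P : R -> Prop) (d : R) :
  P 0 ->
  (forall t, 0 <= t < d -> P t ->
     exists2 e, 0 < e & forall u, t <= u < t + e -> P u) ->
  (forall t, 0 < t <= d -> (forall u, 0 <= u < t -> P u) -> P t) ->
  forall t, 0 <= t <= d -> P t.
Proof.
move=> P0 Popen Pclosed t1 /andP[t10 t1d].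
(* The supremum [m] of the initial segments on which [P] holds satisfies [P] by the closedness
   hypothesis; openness to the right then forces [m = d]. *)
pose S := [set t : R | 0 <= t <= d /\ forall u, 0 <= u <= t -> P u].
have S0 : S 0.
  by split; [lra|move=> u u0; have -> : u = 0 by lra].
have supS : has_sup S by split; [exists 0|exists d => t [+ _]; lra].
set m := sup S.
have m0 : 0 <= m by apply: sup_upper_bound.
have md : m <= d by apply: ge_sup; [exists 0|move=> t [+ _]; lra].
have Plt u : 0 <= u < m -> P u.
  move=> um; have [|t [_ Pt] mt] := @sup_adherent _ S (m - u) _ supS; first lra.
  by apply: Pt; rewrite -/m in mt; lra.
have Pm : P m.
  by have [<-//|mN0] := eqVneq 0 m; apply: Pclosed => //; lra.
have Sm : S m.
  split=> [|u um]; first by rewrite m0.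
  by have [->//|uNm] := eqVneq u m; apply: Plt; lra.
suff md' : m = d by apply: Sm.2; rewrite md' t10.
apply/eqP; rewrite eq_le md /= leNgt; apply/negP => mltd.
have [|e e0 Pe] := Popen m _ Pm; first by rewrite m0.
pose t := Num.min d (m + e / 2).
have [tm te td] : [/\ m < t, t < m + e & t <= d].
  by rewrite /t minEle; case: ifP => ?; split; lra.
have St : S t.
  split=> [|u ut]; first lra.
  by case: (ltP u m) => um; [apply: Plt|apply: Pe]; lra.
by have := sup_upper_bound supS St; rewrite -/m; lra.
Qed.

(** More than [e^-1] boxes of length [e] cover the unit interval, and two terms among one more than
    the number of boxes share a box. *)
Lemma pigeonhole_dist (R : realType) (s : nat -> R) (e : R) :
  (forall m, 0 <= s m <= 1) -> 0 < e ->
  exists i j, (i < j)%N /\ `|s i - s j| < e.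
Proof.
move=> s01 e0; pose N := (Num.trunc e^-1).+1.
pose f (i : 'I_N.+1) : 'I_N := inord (Num.trunc (s i / e)).
have sN m : (Num.trunc (s m / e) < N)%N.
  have /andP[s0 s1] := s01 m; rewrite ltnS; apply: le_truncn.
  by rewrite ler_piMl// invr_ge0 ltW.
have : ~ injective f.
  by move=> /leq_card; rewrite !card_ord ltnn.
move=> /injectiveP/injectivePn[i [j ij]].
move=> /(congr1 val); rewrite /= !inordK// => eij.
have close : `|s i - s j| < e.
  have bnd m : (Num.trunc (s m / e))%:R * e <= s m < (Num.trunc (s m / e))%:R * e + e.
    have /andP[s0 s1] := s01 m.
    have := @truncn_itv _ (s m / e) (divr_ge0 s0 (ltW e0)).
    by rewrite ler_pdivlMr// ltr_pdivrMr// -natr1 mulrDl mul1r.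
  have := bnd i; have := bnd j; rewrite eij ltr_norml; lra.
case: (ltngtP i j) => [lt|lt|/val_inj ji]; first by exists i, j.
  by exists j, i; rewrite distrC.
by rewrite ji eqxx in ij.
Qed.

Lemma ex_common_pos (R : realType) (I : finType) (F : I -> R -> Prop) :
  (forall i d d', 0 < d' <= d -> F i d -> F i d') ->
  (forall i, exists2 d, 0 < d & F i d) ->
  exists2 d, 0 < d & forall i, F i d.
Proof.
move=> Fle ex; have /choice[dl dlP] : forall i, exists d, 0 < d /\ F i d.
  by move=> i; have [d] := ex i; exists d.
have m0 : 0 < \big[Num.min/1]_i dl i by apply: lt_bigmin => // i _; case: (dlP i).
exists (\big[Num.min/1]_i dl i) => // i; apply: (Fle i (dl i)); last by case: (dlP i).
by rewrite m0 bigmin_le.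
Qed.

Lemma unitIP (R : realType) (z : R) : unitI R z <-> 0 <= z < 1.
Proof. by rewrite /unitI /= in_itv. Qed.

Lemma periodic_finite_orbit (X : Type) (g : X -> X) (x : X) (k : nat) :
  (0 < k)%N -> iter k g x = x -> finite_set (orbit_set g x).
Proof.
move=> k0 per; apply: sub_finite_set (finite_image (fun j => iter j g x) (finite_II k)).
move=> _ [l _ <-]; exists (l %% k)%N => /=; first by rewrite ltn_mod.
rewrite {2}(divn_eq l k); elim: (l %/ k)%N => [|q IH]; first by rewrite mul0n.
by rewrite mulSn -addnA addnC iterD per.
Qed.

(** * Interval exchanges with the i.d.o.c.: no connections, no periodic points, dense orbits *)

Section IET.
Variables (R : realType) (n : nat) (T : R -> R) (Q : 'I_n -> set R).
Hypotheses (T_IET : is_IET T Q) (T_idoc : idoc T Q) (n_gt1 : (2 <= n)%N).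
Local Notation a i := (inf (Q i)).
Implicit Types (i j : 'I_n) (u v w z : R).

Let partQ : interval_partition Q. Proof. by case: T_IET. Qed.
Let T_fun : set_fun (unitI R) (unitI R) T. Proof. by case: T_IET => -[]. Qed.

Lemma IET_unitI z : unitI R z -> 0 <= T z < 1.
Proof. by move=> /T_fun/unitIP. Qed.

Lemma IET_inj u v : unitI R u -> unitI R v -> T u = T v -> u = v.
Proof.
by case: T_IET => -[_ T_inj _] _ _ _ Iu Iv; apply: T_inj; rewrite inE.
Qed.

(** A total function standing for [T^-1], so that backward orbits can be iterated. *)
Lemma IET_inverse : exists U : R -> R,
  forall z, unitI R z -> unitI R (U z) /\ T (U z) = z.
Proof.
case: T_IET => -[_ _ T_surj] _ _ _.
have /choice[U UP] : forall z, exists u, unitI R z -> unitI R u /\ T u = z.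
  move=> z; case: (pselect (unitI R z)) => [/T_surj[u Iu uz]|nIz].
    by exists u.
  by exists 0 => /nIz.
by exists U.
Qed.

(** A piece is nonempty and left-closed, so the infimum used in [idoc] is an attained left
    endpoint. *)
Lemma IET_piece i : exists2 b, a i < b & forall z, Q i z <-> a i <= z < b.
Proof.
case: T_IET => _ _ /(_ i)[l [b Qi]] _; case: partQ => -[_ _ /(_ i I)[z Qz]] _ _ _.
have lb : l < b by move: Qz; rewrite Qi /= in_itv /=; lra.
have -> : a i = l by rewrite Qi inf_itv// bnd_simp.
by exists b => // w; rewrite Qi /= in_itv.
Qed.

Lemma left_piece i : Q i (a i).
Proof. by have [b ab ->] := IET_piece i; lra. Qed.

Lemma left_le i z : Q i z -> a i <= z.
Proof. by have [b _ ->] := IET_piece i; lra. Qed.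

Lemma piece_down i u v : Q i v -> a i <= u <= v -> Q i u.
Proof. by have [b _ QE] := IET_piece i; rewrite !QE; lra. Qed.

Lemma piece_near i z : Q i z -> exists2 e, 0 < e &
  forall s, `|s| < e -> 0 <= s \/ a i < z -> Q i (z + s).
Proof.
have [b _ QE] := IET_piece i; rewrite QE => zb.
exists (Num.min (b - z) (if a i < z then z - a i else 1)).
  by rewrite lt_min; apply/andP; split; [|case: ifP]; lra.
move=> s; rewrite lt_min !ltr_norml QE => /andP[sb sa] [s0|az]; first lra.
by rewrite az in sa; lra.
Qed.

Lemma IET_translation i u v : Q i u -> Q i v -> T v = T u + (v - u).
Proof. by case: T_IET => _ _ _ [b Tb] /Tb -> /Tb ->; lra. Qed.

Lemma left_unitI i : 0 <= a i < 1.
Proof. exact/unitIP/(piece_unitI partQ (left_piece i)). Qed.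

Lemma IET_local u v : unitI R v -> u <= v ->
  (forall j, ~ (u < a j <= v)) -> T v = T u + (v - u).
Proof.
move=> /(piece_cover partQ)[j Qv] uv noa; apply: (@IET_translation j) => //.
have av := left_le Qv; apply: piece_down Qv _; rewrite uv andbT leNgt.
by apply/negP => ua; apply: (noa j); rewrite ua av.
Qed.

(** The points [T (a j)] are the left endpoints of the pieces of [T^-1]. If none separates [T u]
    from [T v], the image of the piece of [v] reaches down to [T u], and injectivity puts [u] in
    that piece. *)
Lemma IET_inv_local u v : unitI R u -> unitI R v -> T u <= T v ->
  (forall j, ~ (T u < T (a j) <= T v)) -> v = u + (T v - T u).
Proof.
move=> Iu Iv uv noa; have [j Qv] := piece_cover partQ Iv.
have Tv := IET_translation (left_piece j) Qv; have av := left_le Qv.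
have au : T (a j) <= T u.
  by rewrite leNgt; apply/negP => lt; apply: (noa j); rewrite lt/=; lra.
have Qw : Q j (a j + (T u - T (a j))) by apply: piece_down Qv _; lra.
have Tw := IET_translation (left_piece j) Qw.
have uw : u = a j + (T u - T (a j)).
  by apply: IET_inj => //; [exact: piece_unitI Qw|lra].
lra.
Qed.

Lemma left_gt0 i : (0 < i)%N -> 0 < a i.
Proof.
move=> i0; pose j : 'I_n := Ordinal (ltn_trans i0 (ltn_ord i)).
have := piece_lt partQ (i0 : (j < i)%N) (left_piece j) (left_piece i).
by have := left_unitI j; lra.
Qed.

Lemma left_eq0 i : i = 0%N :> nat -> a i = 0.
Proof.
have [j Qj] : exists j, Q j 0 by apply: (piece_cover partQ); apply/unitIP; lra.
have aj := left_le Qj; have := left_unitI j => aj0 i0.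
case: (posnP j) => [j0|/left_gt0]; last lra.
have -> : i = j by apply/val_inj; rewrite /= i0 j0.
lra.
Qed.

(** Distinct endpoints have disjoint orbits, and an endpoint returning to itself would have a finite
    orbit. *)
Lemma no_connection i j (k : nat) : (0 < i)%N -> (0 < j)%N -> (0 < k)%N ->
  iter k T (a i) <> a j.
Proof.
case: T_idoc => inforb disj i0 j0 k0 e; have [ij|ij] := eqVneq i j.
  by apply: (inforb i i0); apply: (periodic_finite_orbit k0); rewrite e ij.
have : (orbit_set T (a i) `&` orbit_set T (a j)) (a j).
  by split; [exists k|exists 0%N].
by rewrite disj.
Qed.

(** The preimage of 0 is a left endpoint. If it were 0, [T] would fix the first piece pointwise. The
    preimage of its right end [a p] would then be a left endpoint, which is a connection or
    contradicts [T 0 = 0], or an interior point, whose left neighbours have the same images as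
    points of the first piece. *)
Lemma zero_image : exists2 i : 'I_n, (0 < i)%N & T (a i) = 0.
Proof.
have [U UP] := IET_inverse; have I0 : unitI R 0 by apply/unitIP; lra.
have [Iz Tz] := UP _ I0; have [j Qj] := piece_cover partQ Iz.
have zE : U 0 = a j.
  have := IET_translation (left_piece j) Qj; have := left_le Qj.
  by have := IET_unitI (piece_unitI partQ (left_piece j)); lra.
have [j0|j0] := posnP j; last by exists j; rewrite // -zE.
have aj0 := left_eq0 j0; rewrite zE aj0 in Tz Qj.
have fixj w : Q j w -> T w = w by move=> /(IET_translation Qj); lra.
have [p p0 pmin] : exists2 p : 'I_n, (0 < p)%N & forall i, (0 < i)%N -> (p <= i)%N.
  by exists (Ordinal n_gt1).
have [Iy Ty] := UP _ (piece_unitI partQ (left_piece p)).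
have [l Ql] := piece_cover partQ Iy; have ap0 := left_gt0 p0.
have lowj w : 0 <= w < a p -> Q j w.
  move=> wp; have [i Qi] : exists i, Q i w.
    by apply/(piece_cover partQ)/unitIP; have := left_unitI p; lra.
  suff -> : j = i by [].
  apply/val_inj; rewrite /= j0; case: (posnP i) => // i0; exfalso.
  have := pmin i i0; rewrite leq_eqVlt => /predU1P[/val_inj pi|pi].
    by have := left_le Qi; rewrite -{}pi; lra.
  by have := piece_lt partQ pi (left_piece p) Qi; lra.
have [yE|yN] := eqVneq (U (a p)) (a l).
  have [l0|l0] := posnP l.
    by move: Ty; rewrite yE (left_eq0 l0) Tz; lra.
  by have := @no_connection l p 1 l0 p0 isT; rewrite /= -yE Ty.
have al := left_le Ql.
pose s := Num.min (U (a p) - a l) (a p).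
have [s0 sl sp] : [/\ 0 < s, s <= U (a p) - a l & s <= a p].
  by move/eqP in yN; rewrite /s minEle; case: ifP => ?; split; lra.
have Qs : Q l (U (a p) - s) by apply: piece_down Ql _; lra.
have Qjs : Q j (a p - s) by apply: lowj; lra.
have Ts : T (U (a p) - s) = T (a p - s).
  by rewrite (fixj _ Qjs) (IET_translation Ql Qs); lra.
have wE := IET_inj (piece_unitI partQ Qs) (piece_unitI partQ Qjs) Ts.
rewrite wE in Qs; rewrite -(piece_inj partQ Qjs Qs) in Ql.
have jp : j <> p by move=> jp; rewrite -jp j0 in p0.
by case: jp; apply: (piece_inj partQ Ql); rewrite -(fixj _ Ql) Ty; apply: left_piece.
Qed.

(** Pieces are left-closed, so small shifts to the right are always carried along by [T^k]; shifts
    to the left need an orbit that avoids the discontinuities. The last clause says that the first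
    [k] letters do not change. *)
Lemma iter_translation z (k : nat) : unitI R z -> exists2 e, 0 < e &
  forall s, `|s| < e ->
    0 <= s \/ (0 < z /\ forall (j : nat) i, (j < k)%N -> (0 < i)%N -> iter j T z <> a i) ->
    [/\ unitI R (z + s),
        forall j : nat, (j <= k)%N -> iter j T (z + s) = iter j T z + s
      & forall j : nat, (j < k)%N ->
          exists2 i, Q i (iter j T z) & Q i (iter j T (z + s))].
Proof.
move=> Iz; have [m m0 Tm] := zero_image.
elim: k => [|k [e e0 eP]].
  have {}Iz := (unitIP _).1 Iz.
  exists (Num.min (1 - z) (if 0 < z then z else 1)).
    by rewrite lt_min; apply/andP; split; [|case: ifP]; lra.
  move=> s; rewrite lt_min !ltr_norml => /andP[s1 sz] cond; split=> //.
    apply/unitIP; case: cond => [s0|[z0 _]]; first lra.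
    by rewrite z0 in sz; lra.
  by move=> j; rewrite leqn0 => /eqP ->.
have Iw := iter_unitI T_fun k Iz.
have [i Qi] := piece_cover partQ Iw; have [e' e'0 Qe] := piece_near Qi.
exists (Num.min e e'); first by rewrite lt_min e0 e'0.
move=> s; rewrite lt_min => /andP[se se'] cond.
have [|Izs trans same] := eP _ se.
  by case: cond => [|[z0 noa]]; [left|right; split=> // j l /ltnW; apply: noa].
have Qs : Q i (iter k T z + s).
  apply: Qe => //; case: cond => [|[z0 noa]]; [by left|right].
  rewrite lt_neqAle (left_le Qi) andbT; apply/eqP => aw.
  have [i0|i0] := posnP i; last exact: (noa k i).
  (* An iterate equal to 0 is either [z] itself, which is positive, or the image of the
     discontinuity [a m], which the orbit avoids. *)
  rewrite (left_eq0 i0) in aw; case: (k) noa Iw aw => [|k'] noa Iw /= aw; first lra.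
  apply: (noa k' m) => //.
  apply: IET_inj; [exact: iter_unitI|exact: piece_unitI (left_piece m)|].
  by rewrite -aw Tm.
split=> // j; rewrite leq_eqVlt => /predU1P[].
- by move=> ->; rewrite !iterS trans// (IET_translation Qi Qs); lra.
- exact: trans.
- by case=> ->; exists i; rewrite ?trans.
- exact: same.
Qed.

(** Periodicity propagates leftwards from [z] down to 0: it is an open condition since a periodic
    orbit meets no discontinuity, and it passes to limits from the right since [T^k] is
    right-continuous. Then 0 is periodic, and so is its preimage [a m], against the i.d.o.c. *)
Lemma no_periodic z (k : nat) : unitI R z -> (0 < k)%N -> iter k T z <> z.
Proof.
move=> Iz k0 per; have [m m0 Tm] := zero_image.
have left_nper (i : 'I_n) : (0 < i)%N -> iter k T (a i) <> a i by move=> i0; apply: no_connection.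
have z01 := (unitIP z).1 Iz.
suff : iter k T (z - z) = z - z.
  rewrite subrr -{1}Tm -iterSr iterS -Tm => e.
  apply: (left_nper m m0); apply: IET_inj e; last exact: piece_unitI (left_piece m).
  exact/(iter_unitI T_fun)/(piece_unitI partQ (left_piece m)).
pose P t := iter k T (z - t) = z - t.
apply: (@real_induction _ P z) => [|t tz Pt|t tz Pt|]; rewrite /P.
- by rewrite subr0.
- have [e e0 eP] : exists2 e, 0 < e & forall s, `|s| < e -> iter k T (z - t + s) = z - t + s.
    have Izt : unitI R (z - t) by apply/unitIP; lra.
    have [e e0 eP] := iter_translation k Izt; exists e => // s /eP[|_ tr _].
      right; split=> [|j i jk i0 e']; first lra.
      by apply: (left_nper i i0); rewrite -e' -iterD addnC iterD Pt.
    by rewrite tr// Pt.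
  exists e => // u ut; have := eP (t - u); rewrite (_ : z - t + (t - u) = z - u); last lra.
  by apply; rewrite ltr_norml; lra.
- have Izt : unitI R (z - t) by apply/unitIP; lra.
  have [e e0 eP] := iter_translation k Izt.
  pose s := Num.min t (e / 2).
  have [s0 se st] : [/\ 0 < s, s < e & s <= t].
    by rewrite /s minEle; case: ifP => ?; split; lra.
  have [|| _ tr _] := eP s; [by rewrite ltr_norml; lra|by left; lra|].
  have := Pt (t - s); rewrite /P (_ : z - (t - s) = z - t + s); last lra.
  by rewrite tr// => per'; have := per' ltac:(lra); lra.
- lra.
Qed.

(* An endpoint [c] of a component of the complement of [A] is moved by [T] and
   by [T^-1] to endpoints of gaps of size at least [e] on the same side, until it
   meets a discontinuity of [T], resp. of [T^-1]. Such endpoints being finitely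
   many and [T] having no periodic point, both happen, so some iterate of a
   discontinuity is a discontinuity. *)
Lemma invariant_closed_full (A : R -> Prop) :
  (forall z, 0 < z < 1 -> ~ A z ->
     exists2 d, 0 < d & forall w, `|w - z| < d -> ~ A w) ->
  (forall z, 0 < z < 1 -> (forall i, (0 < i)%N -> z <> a i) -> A z <-> A (T z)) ->
  (exists2 p, 0 < p < 1 & A p) -> forall q, 0 < q < 1 -> A q.
Proof.
move=> Acl Ainv [p p01 Ap] q q01; apply: contrapT => nAq.
have open01 w : 0 < w < 1 -> unitI R w by move=> w01; apply/unitIP; lra.
have T_inj : set_inj (unitI R) T by case: T_IET => -[].
have [m m0 Tm] := zero_image.
have [U UP] := IET_inverse.
have T_neq0 z : 0 < z < 1 -> (forall i, (0 < i)%N -> z <> a i) -> T z <> 0.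
  move=> z01 za; rewrite -Tm => e; apply: (za m m0); apply: IET_inj e.
    by apply/unitIP; lra.
  exact/unitIP/left_unitI.
(* On the way from [q] to [p], [c] is the first point of [A] met, and [s] is the direction from [c]
   back into the gap. *)
have [s s1 [e0 [c [e00 c01 Ac gapc]]]] : exists2 s : R, s = 1 \/ s = -1 & exists e c,
    [/\ 0 < e, 0 < c < 1, A c
      & forall t, 0 < t < e -> 0 < c + s * t < 1 /\ ~ A (c + s * t)].
  have [s s1 [d d0 pE]] : exists2 s : R, s = 1 \/ s = -1 & exists2 d, 0 < d & p = q - s * d.
    have [pq|] := ltP p q.
      by exists 1; [left|exists (q - p); lra].
    rewrite le_eqVlt => /predU1P[qp|qp]; first by rewrite qp in nAq.
    by exists (- 1); [right|exists (p - q); lra].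
  exists s => //; apply: contrapT => nogap.
  suff : ~ A (q - s * d) by rewrite -pE.
  apply: (@real_induction _ (fun t => ~ A (q - s * t)) d); last lra.
  - by rewrite mulr0 subr0.
  - move=> t td nAt.
    have [|e e0 eP] := Acl _ _ nAt; first by case: s1 => se; rewrite se in pE *; lra.
    exists e => // u ut; apply: eP.
    by rewrite ltr_norml; case: s1 => ->; lra.
  - move=> t td nAt At; apply: nogap; exists t, (q - s * t); split=> //; first lra.
      by case: s1 => se; rewrite se in pE *; lra.
    move=> r rt; rewrite (_ : q - s * t + s * r = q - s * (t - r)); last lra.
    split; last by apply: nAt; lra.
    by case: s1 => se; rewrite se in pE *; lra.
(* Below this size, no gap next to a point of [A] contains a discontinuity of [T] or of [T^-1]. *)
have [e1 e10 e1P] : exists2 e, 0 < e & forall i w, w = a i \/ w = T (a i) ->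
    0 < w < 1 -> ~ A w -> forall v, A v -> e <= `|w - v|.
  have far w : exists2 e, 0 < e & 0 < w < 1 -> ~ A w -> forall v, A v -> e <= `|w - v|.
    have [w01|w01] := pselect (0 < w < 1); last by exists 1.
    have [Aw|nAw] := pselect (A w); first by exists 1.
    have [d d0 dP] := Acl w w01 nAw; exists d => // _ _ v Av.
    by rewrite leNgt distrC; apply/negP => /dP.
  apply: ex_common_pos => [i d d' dd' Fd w wi w01 nAw v Av|i].
    by apply: le_trans (Fd w wi w01 nAw v Av); lra.
  have [d1 d10 d1P] := far (a i); have [d2 d20 d2P] := far (T (a i)).
  exists (Num.min d1 d2); first by rewrite lt_min d10 d20.
  move=> w [->|->] w01 nAw v Av; rewrite ge_min.
    by rewrite d1P.
  by rewrite d2P ?orbT.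
pose e := Num.min e0 e1.
have e_gt0 : 0 < e by rewrite lt_min e00 e10.
pose B z := [/\ 0 < z < 1, A z
  & forall t, 0 < t < e -> 0 < z + s * t < 1 /\ ~ A (z + s * t)].
have Bc : B c.
  split=> // t te; apply: gapc; move: te; rewrite /e lt_min.
  by case/andP => ? /andP[? ?]; lra.
have Bsep u v : B u -> B v -> `|u - v| < e -> u = v.
  wlog uv : u v / 0 < s * (v - u).
    move=> wl Bu Bv uve; have [//|uNv] := eqVneq u v.
    have [ltuv|leuv] := ltP 0 (s * (v - u)); first exact: wl.
    apply/esym/wl => //; last by rewrite distrC.
    by move/eqP in uNv; case: s1 => se; rewrite se in leuv *; lra.
  move=> [_ _ gap] [_ Av _] uve; case: (gap (s * (v - u))).
    by move: uve; rewrite ltr_norml; case: s1 => se; rewrite se in uv *; lra.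
  by move=> _ []; rewrite (_ : u + _ = v)//; case: s1 => ->; lra.
have Bfree z i w t : B z -> w = a i \/ w = T (a i) -> 0 < t < e -> w <> z + s * t.
  move=> [_ Az gap] wi te wE; have [w01 nAw] := gap t te.
  rewrite -wE in w01 nAw; have := e1P i w wi w01 nAw z Az.
  rewrite wE (_ : z + s * t - z = s * t); last lra.
  have -> : `|s * t| = t.
    by case: s1 => ->; rewrite ?mul1r ?mulN1r ?normrN gtr0_norm//; lra.
  by move: te; rewrite /e lt_min => /andP[_ /andP[_ ?]]; lra.
have BT z : B z -> (forall i, (0 < i)%N -> z <> a i) -> B (T z).
  move=> Bz za; have [z01 Az gap] := Bz.
  have za' i : z <> a i.
    by have [i0|] := posnP i; [rewrite (left_eq0 i0); lra|exact: za].
  have Tst t : 0 < t < e -> T z + s * t = T (z + s * t).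
    move=> te; have [zt01 _] := gap t te; case: s1 => se; rewrite se in zt01 *.
      rewrite (@IET_local z (z + 1 * t)); [lra|by apply: open01; lra|lra|].
      move=> j aj; apply: (@Bfree z j (a j) (a j - z)) => //; first by left.
        by lra.
      by rewrite se; lra.
    rewrite (@IET_local (z + -1 * t) z); [lra|by apply: open01; lra|lra|].
    move=> j aj; apply: (@Bfree z j (a j) (z - a j)) => //; first by left.
      by have /eqP := za' j; lra.
    by rewrite se; lra.
  split.
  - have := IET_unitI (open01 _ z01).
    by have := T_neq0 z z01 za; lra.
  - exact/(Ainv z z01 za).
  - move=> t te; have [zt01 nAt] := gap t te; rewrite Tst//.
    have nd i : (0 < i)%N -> z + s * t <> a i.
      by move=> _ /esym; apply: Bfree => //; left.
    split; last by move/(Ainv _ zt01 nd).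
    have := IET_unitI (open01 _ zt01).
    by have := T_neq0 _ zt01 nd; lra.
have BU z : B z -> (forall i, z <> T (a i)) -> B (U z).
  move=> Bz za; have [z01 Az gap] := Bz.
  have U01 w : 0 < w < 1 -> (forall i, w <> T (a i)) ->
      [/\ 0 < U w < 1, forall i, (0 < i)%N -> U w <> a i, T (U w) = w & unitI R (U w)].
    move=> w01 wa; have [Iu Tu] := UP w (open01 _ w01).
    have ua i : U w <> a i by move=> ue; apply: (wa i); rewrite -ue.
    split=> //.
    have := (unitIP _).1 Iu; have := ua (Ordinal (ltnW n_gt1)).
    by rewrite left_eq0//; lra.
  have [Uz01 Uza TUz IUz] := U01 z z01 za.
  split=> //; first by apply/(Ainv _ Uz01 Uza); rewrite TUz.
  move=> t te; have [zt01 nAt] := gap t te.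
  have zta i : z + s * t <> T (a i).
    by move=> /esym; apply: (@Bfree z i) => //; right.
  have [Ut01 Uta TUt IUt] := U01 _ zt01 zta.
  have -> : U z + s * t = U (z + s * t).
    case: s1 => se; rewrite se in zt01 zta TUt IUt *.
      rewrite (@IET_inv_local (U z) (U (z + 1 * t))) ?TUz ?TUt//; [lra|lra|].
      move=> j aj; apply: (@Bfree z j (T (a j)) (T (a j) - z)) => //; first by right.
        by lra.
      by rewrite se; lra.
    rewrite (@IET_inv_local (U (z + -1 * t)) (U z)) ?TUz ?TUt//; [lra|lra|].
    move=> j aj; apply: (@Bfree z j (T (a j)) (z - T (a j))) => //; first by right.
      by have /eqP := za j; lra.
    by rewrite se; lra.
  by split=> // AU; apply: nAt; rewrite -TUt; apply/(Ainv _ Ut01 Uta).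
have IB z : B z -> unitI R z by case=> ? _ _; apply/unitIP; lra.
have B01 z : B z -> 0 <= z <= 1 by case=> ? _ _; lra.
(* Otherwise the whole orbit stays in [B]; two of its terms are closer than [e], hence equal by
   [Bsep], and [c] is periodic. *)
have [k [j j0 kj]] : exists k, exists2 j : 'I_n, (0 < j)%N & iter k T c = a j.
  apply: contrapT => no; have Bk k : B (iter k T c).
    by elim: k => //= k Bk; apply: BT => // i i0 ki; apply: no; exists k, i.
  have [k [l [kl close]]] := pigeonhole_dist (fun k => B01 _ (Bk k)) e_gt0.
  have lE : l = (k + (l - k))%N by rewrite subnKC// ltnW.
  have := Bsep _ _ (Bk k) (Bk l) close; rewrite {1}lE iterD => /esym per.
  apply: (no_periodic (IB _ Bc) (k := l - k)); first by rewrite subn_gt0.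
  by apply: (iter_set_inj T_fun T_inj _ _ per); rewrite inE; exact: IB.
have [l [i i0 li]] : exists l, exists2 i : 'I_n, (0 < i)%N & iter l.+1 T (a i) = c.
  apply: contrapT => no.
  have iterVU l : (forall k, (k < l)%N -> B (iter k U c)) -> iter l T (iter l U c) = c.
    elim: l => // l IH Bk; rewrite iterSr iterS.
    have [_ ->] := UP _ (IB _ (Bk l (ltnSn l))).
    by apply: IH => k' kl; apply: Bk; apply: ltnW.
  have Bk k' : B (iter k' U c).
    have [l] := ubnP k'; elim: l k' => // l IH [|k'] // kl.
    have Bk'' := IH k' kl.
    apply: BU => // i ki; apply: no.
    have Tk : iter k'.+1 T (a i) = c.
      by rewrite iterSr -ki; apply: iterVU => r rk; apply: IH; exact: ltn_trans rk kl.
    have [i0|i0] := posnP i; last by exists k', i.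
    (* The endpoint 0 is the image of [a m], so one more step back reaches an endpoint of positive
       index. *)
    by exists k'.+1, m => //; rewrite iterSr Tm -(left_eq0 i0).
  have [k' [l [kl close]]] := pigeonhole_dist (fun k => B01 _ (Bk k)) e_gt0.
  have UkUl := Bsep _ _ (Bk k') (Bk l) close.
  apply: (no_periodic (IB _ Bc) (k := l - k')); first by rewrite subn_gt0.
  rewrite -{1}(iterVU k' (fun r _ => Bk r)) -iterD subnK; last exact: ltnW.
  by rewrite UkUl iterVU.
have := @no_connection i j (k + l.+1) i0 j0; rewrite iterD li; apply => //.
by rewrite addnS.
Qed.

(** The limit set [A] of the orbit is closed and is invariant away from the discontinuities, so
    [invariant_closed_full] applies once [A] has a point in the open unit interval. Asking for
    arbitrarily late visits lets invariance run backwards too. *)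
Lemma IET_dense_orbit y z d (N : nat) : unitI R y -> 0 < z < 1 -> 0 < d ->
  exists2 m, (N <= m)%N & `|iter m T y - z| < d.
Proof.
move=> Iy; pose A v := forall d (N : nat), 0 < d ->
  exists2 m, (N <= m)%N & `|iter m T y - v| < d.
suff : forall z, 0 < z < 1 -> A z by move=> /(_ z) Az /Az; apply.
have Im m : unitI R (iter m T y) by apply: iter_unitI.
have IE w : 0 < w < 1 -> unitI R w by move=> w01; apply/unitIP; lra.
have [i i0 Ti] := zero_image.
have loc w : unitI R w -> exists2 e, 0 < e & forall x, `|x - w| < e ->
    w <= x \/ (0 < w /\ forall j, (0 < j)%N -> w <> a j) ->
    unitI R x /\ T x = T w + (x - w).
  move=> Iw; have [e e0 eP] := iter_translation 1 Iw; exists e => // x xw cond.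
  have [|] := eP (x - w) xw.
    by case: cond => [?|[w0 wa]]; [left; lra|right; split=> // -[|//] j _; exact: wa].
  rewrite (_ : w + (x - w) = x); last lra.
  by move=> Ix /(_ 1%N isT).
have A_image w v e : 0 < e -> A w ->
    (forall m, `|iter m T y - w| < e -> iter m.+1 T y = v + (iter m T y - w)) -> A v.
  move=> e0 Aw H d' N' d'0.
  have [|m Nm] := Aw (Num.min d' e) N'; first by rewrite lt_min d'0.
  rewrite lt_min => /andP[md me]; exists m.+1; first exact: leqW.
  by rewrite H// (_ : v + _ - v = iter m T y - w)//; lra.
apply: invariant_closed_full => [w w01 nA|w w01 wa|].
- move: nA => /existsNP[d1 /existsNP[N1 /not_implyP[d10 far]]].
  exists (d1 / 2) => [|x xw Ax]; first lra.
  have [|m Nm mx] := Ax (d1 / 2) N1; first lra.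
  apply: far; exists m => //; move: xw mx; rewrite !ltr_norml; lra.
- have [e e0 eP] := loc w (IE w w01); split=> [Aw|ATw].
    apply: (A_image w _ e) => // m mw.
    by have [|_ Tm] := eP _ mw; [right; split => //; lra|rewrite iterS Tm].
  move=> d' N' d'0.
  have [|[|m] Nm] := ATw (Num.min d' e) N'.+1; rewrite ?lt_min ?d'0//.
  move=> /andP[md me]; exists m => //.
  pose x := w + (iter m.+1 T y - T w).
  have xw : x - w = iter m.+1 T y - T w by rewrite /x; lra.
  have [||Ix Tx] := eP x; first by rewrite xw.
    by right; split=> //; lra.
  rewrite (_ : iter m T y = x) ?xw//; apply: IET_inj => //.
  by rewrite Tx xw /=; lra.
(* Compactness gives a limit point [v]. If it is 0 or 1, its image, or the left limit of [T] at 1,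
   is a limit point strictly inside. *)
- have [v v01 Av] : exists2 v, 0 <= v <= 1 & A v.
    pose u m := iter m T y.
    have [|v [v01 clv]] := @segment_compact R 0 1 (u @ \oo) _.
      by exists 0%N => // m _ /=; rewrite in_itv /=; have /unitIP := Im m; rewrite /u; lra.
    exists v => [|d' N' d'0]; first by move: v01; rewrite /= in_itv.
    have [|_ [[m Nm <-]] vm] := clv [set u m | m in [set m | (N' <= m)%N]] (ball v d') _ (nbhsx_ballx v d' d'0).
      by exists N' => // m Nm; exists m.
    by exists m => //; rewrite distrC.
  have [v0|[v1|v01']] : v = 0 \/ v = 1 \/ 0 < v < 1.
    have [->|v0] := eqVneq v 0; first by left.
    have [->|v1] := eqVneq v 1; first by right; left.
    by right; right; move/eqP in v0; move/eqP in v1; lra.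
  + have I0 : unitI R 0 by apply/unitIP; lra.
    have T0 : T 0 <> 0.
      rewrite -{2}Ti => /IET_inj e; have := left_gt0 i0.
      by rewrite -e//; [lra|exact/unitIP/left_unitI].
    exists (T 0); first by have := IET_unitI I0; lra.
    have [e e0 eP] := loc 0 I0; rewrite v0 in Av.
    apply: (A_image 0 _ e) => // m m0.
    have [|_ Tm] := eP _ m0; last by rewrite iterS Tm.
    by left; have /unitIP := Im m; lra.
  + have n0 := ltnW n_gt1.
    have [l l0 lmax] : exists2 l : 'I_n, (0 < l)%N & forall j, (j <= l)%N.
      have ln : (n.-1 < n)%N by rewrite ltn_predL.
      exists (Ordinal ln) => [|j] /=; first by rewrite -ltnS prednK.
      by rewrite -ltnS prednK.
    have al01 := left_unitI l; have Tal := IET_unitI (piece_unitI partQ (left_piece l)).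
    have Tw w : a l <= w < 1 -> T w = T (a l) + (1 - a l) + (w - 1).
      move=> wl; have [j Qj] : exists j, Q j w.
        by apply/(piece_cover partQ)/unitIP; lra.
      have -> : T w = T (a l) + (w - a l); last lra.
      apply: IET_translation (left_piece l) _; suff -> : l = j by [].
      apply/val_inj/eqP; rewrite eqn_leq lmax andbT.
      by apply: (piece_le partQ (left_piece l) Qj); lra.
    have Tlt w : a l <= w < 1 -> T (a l) + (1 - a l) + (w - 1) < 1.
      move=> wl; rewrite -Tw//.
      have /IET_unitI : unitI R w by apply/unitIP; lra.
      by lra.
    have p0 : T (a l) <> a l by apply: (@no_connection l l 1).
    exists (T (a l) + (1 - a l)).
      have [le1|gt1] := leP (T (a l)) (a l); first lra.
      (* If the left limit of [T] at 1 exceeded 1, this point of the last piece would be sent to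
         1. *)
      by have := Tlt (2 - (T (a l) + (1 - a l))) ltac:(lra); lra.
    rewrite v1 in Av; apply: (A_image 1 _ (1 - a l)) => // [|m]; first lra.
    rewrite ltr_norml => m1; apply: (Tw (iter m T y)).
    by have /unitIP := Im m; lra.
  + by exists v.
Qed.

(** Let [p] be the preimage of [a i] under [T^k]. Its first [k] iterates meet no discontinuity, so
    nearby points on both sides share the first [k] letters, while the next letter is [i] on the
    right and smaller on the left. Density yields visits on both sides. *)
Lemma IET_cuts y (theta : nat -> 'I_n) (k : nat) i :
  unitI R y -> codes T Q y theta -> (0 < i)%N -> i \in cuts theta k.
Proof.
move=> Iy cod i0; have [U UP] := IET_inverse.
have [m0 m00 Tm0] := zero_image.
have Iai := piece_unitI partQ (left_piece i).
have [p Ip kp] : exists2 p, unitI R p & iter k T p = a i.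
  elim: k => [|k [p Ip kp]]; first by exists (a i).
  by have [IU TU] := UP _ Ip; exists (U p); rewrite // iterSr TU.
have p0 : 0 < p.
  have /unitIP := Ip; rewrite le_eqVlt => /andP[/predU1P[p0|->//]] _.
  case: (@no_connection m0 i k.+1) => //.
  by rewrite iterSr Tm0 p0 kp.
have noa (j : nat) (i' : 'I_n) : (j < k)%N -> (0 < i')%N -> iter j T p <> a i'.
  move=> jk i'0 e; apply: (@no_connection i' i (k - j)) => //.
    by rewrite subn_gt0.
  by rewrite -e -iterD subnK// ltnW.
have [e e0 eP] := iter_translation k Ip.
have [e' e'0 Qe'] := piece_near (left_piece i).
pose r := Num.min e e'.
have [r0 re re'] : [/\ 0 < r, r <= e & r <= e'].
  by rewrite /r minEle; case: ifP => ?; split; lra.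
have {}eP x : `|x| < e -> [/\ unitI R (p + x),
      forall j : nat, (j <= k)%N -> iter j T (p + x) = iter j T p + x
    & forall j : nat, (j < k)%N ->
        exists2 i, Q i (iter j T p) & Q i (iter j T (p + x))].
  by move=> xe; apply: eP => //; right.
(* Aiming at [p + r / 2] and [p - r / 2] with tolerance [r / 4] keeps each visit strictly on its
   side of [p] and within [r]. *)
have visit t : t = r / 2 \/ t = - (r / 2) ->
    exists m x, [/\ iter m T y = p + x, `|x - t| < r / 4 & `|x| < r].
  move=> tr.
  have [|/unitIP plow _ _] := eP (- (3 * r / 4)); first by rewrite ltr_norml; lra.
  have [|/unitIP pup _ _] := eP (r / 2); first by rewrite ltr_norml; lra.
  have pt : 0 < p + t < 1 by case: tr => ->; lra.
  have [|m _ mp] := IET_dense_orbit 0 Iy pt (_ : 0 < r / 4); first lra.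
  have pE : iter m T y = p + (iter m T y - p) by lra.
  exists m, (iter m T y - p); split=> //.
    by rewrite (_ : _ - p - t = iter m T y - (p + t))//; lra.
  by move: mp; rewrite !ltr_norml; case: tr => ->; lra.
have [m1 [x1 [m1E]]] := visit _ (or_introl erefl).
have [m2 [x2 [m2E]]] := visit _ (or_intror erefl).
rewrite !ltr_norml => x2r x2r' x1r x1r'.
have [|_ tr1 same1] := eP x1; first by rewrite ltr_norml; lra.
have [|_ tr2 same2] := eP x2; first by rewrite ltr_norml; lra.
have code (m j : nat) x : iter m T y = p + x -> Q (theta (m + j)%N) (iter j T (p + x)).
  by move=> <-; rewrite -iterD addnC; apply: cod.
have c1 := code m1 k x1 m1E; have c2 := code m2 k x2 m2E.
rewrite tr1// kp in c1; rewrite tr2// kp in c2.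
apply/cutsP; exists m1, m2; split.
- apply/factorP => j jk.
  have [j1 Qp1 Q1] := same1 j jk; have [j2 Qp2 Q2] := same2 j jk.
  rewrite (piece_inj partQ (code m1 j x1 m1E) Q1).
  by rewrite (piece_inj partQ (code m2 j x2 m2E) Q2) (piece_inj partQ Qp1 Qp2).
- apply: (piece_inj partQ c1); apply: Qe'; first by rewrite ltr_norml; lra.
  by left; lra.
- rewrite ltnNge leq_eqVlt; apply/negP => /orP[/eqP/val_inj ie|lt].
    by rewrite -ie in c2; have := left_le c2; lra.
  by have := piece_lt partQ lt (left_piece i) c2; lra.
Qed.
End IET.

(** * Complexity of the codings of injective piecewise contractions *)

Theorem corollary2p4 (R : realType) (n : nat) (f : R -> R)
    (P : 'I_n -> set R) (theta : nat -> 'I_n)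
    (f_PC : is_PC f P) (f_inj : set_inj (unitI R) f)
    (theta_coding : exists2 x, unitI R x & codes f P x theta) :
  (exists alpha beta k0 : nat,
     [/\ (alpha <= n - 1)%N, (1 <= beta)%N, (1 <= k0)%N,
         forall k, (k0 <= k)%N ->
           complexity theta k = (alpha * k + beta)%N
       & alpha = (n - 1)%N -> beta = 1%N]) /\
  (forall (T : R -> R) (Q : 'I_n -> set R),
     (2 <= n)%N -> is_IET T Q -> idoc T Q ->
     is_affine_PC (2^-1) f P ->
     (exists h : R -> R,
        [/\ set_fun (unitI R) (unitI R) h,
            {within unitI R, continuous h},
            set_surj (unitI R) (unitI R) h,
            {in unitI R &, {homo h : x y / x <= y}}
          & forall x, unitI R x -> exists2 w : nat -> 'I_n,
              codes f P x w & codes T Q (h x) w]) ->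
     forall k, (1 <= k)%N -> complexity theta k = ((n - 1) * k + 1)%N).
Proof.
have [x Ix cod] := theta_coding.
have nc := PC_noncrossing f_PC f_inj Ix cod.
split; first exact: noncrossing_complexity.
move=> T Q n2 T_IET T_idoc _ [h [h_fun _ _ _ hP]] k _.
have [w codf codT] := hP x Ix.
have partP : interval_partition P by case: f_PC => ? [].
(* Codings are unique, so [theta] is also the coding of [h x] under [T]. *)
rewrite -(codes_inj partP cod codf) in codT.
elim: k => [|k IH]; first by rewrite complexity0 muln0.
rewrite complexityS// IH; suff -> : #|cuts theta k| = (n - 1)%N.
  by rewrite mulnS; lia.
apply/eqP; rewrite eqn_leq card_cuts /=.
(* Every letter except 0 is a cut at every length, so all increments equal [n - 1]. *)
have -> : (n - 1)%N = #|[set~ Ordinal (ltnW n2)]%SET| by rewrite cardsC1 card_ord subn1.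
apply/subset_leq_card/fintype.subsetP => i; rewrite finset.in_setC1 => iN0.
apply: (IET_cuts T_IET T_idoc n2 k (h_fun _ Ix) codT).
by rewrite lt0n; apply: contra iN0 => /eqP i0; apply/eqP/val_inj.
Qed.
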